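(* Let $\mathcal X$ be a quantum set equipped with an order $R$. Let $\tilde P\colon\mathcal X\times\mathcal X^*\to`\mathbb B$ be the function defined by $`1^\dagger\circ\tilde P=E_{\mathcal X}\circ(R^\dagger\times I_{\mathcal X^*})$. Equip $\mathcal X^*$ with the trivial order $I_{\mathcal X^*}$. Then there is a unique monotone function $G\colon(\mathcal X,R)\to[\mathcal X^*,`\mathbb B]_{\sqsubseteq}$ such that $\mathrm{Eval}_{\sqsubseteq}\circ(G\times I_{\mathcal X^*})=\tilde P$ (as morphisms in $\mathbf{qPOS}$), and this $G$ is an order embedding.
   Context: A quantum set $\mathcal X$ is a set $\mathrm{At}(\mathcal X)$ of nonzero finite-dimensional complex Hilbert spaces, called its atoms. $L(X,Y)$ is the space of linear operators $X\to Y$. A binary relation $R$ from $\mathcal X$ to $\mathcal Y$ is a choice of subspaces $R(X,Y)\subseteq L(X,Y)$, one for each atom $X$ of $\mathcal X$ and each atom $Y$ of $\mathcal Y$; a binary relation on $\mathcal X$ is one from $\mathcal X$ to $\mathcal X$. Composition: $(S\circ R)(X,Z)=\sum_{Y} S(Y,Z)\cdot R(X,Y)$, the sum over atoms $Y$ of $\mathcal Y$, where $V\cdot W$ is the span of the products $vw$. Adjoint: $R^\dagger(Y,X)=\{r^\dagger: r\in R(X,Y)\}$. Identity: $I_{\mathcal X}(X,X)=\mathbb C 1_X$, all other components zero. Order and meet are componentwise ($\subseteq$ and $\cap$). A function $F\colon\mathcal X\to\mathcal Y$ is a binary relation with $F^\dagger\circ F\ge I_{\mathcal X}$ and $F\circ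 F^\dagger\le I_{\mathcal Y}$; quantum sets and functions form the category $\mathbf{qSet}$. An order on $\mathcal X$ is a binary relation $R$ with $I_{\mathcal X}\le R$, $R\circ R\le R$, $R\wedge R^\dagger=I_{\mathcal X}$; then $(\mathcal X,R)$ is a quantum poset. A function $F\colon\mathcal X\to\mathcal Y$ is monotone $(\mathcal X,R)\to(\mathcal Y,S)$ if $F\circ R\le S\circ F$, and is an order embedding if $R=F^\dagger\circ S\circ F$. $\mathbf{qPOS}$ is the category of quantum posets and monotone functions. The Cartesian product $\mathcal X\times\mathcal Y$ has one atom $X\otimes Y$ for each pair of atoms, and $(R\times S)(X_1\otimes X_2,Y_1\otimes Y_2)=R(X_1,Y_1)\otimes S(X_2,Y_2)$; for quantum posets, $\mathcal X\times\mathcal Y$ is ordered by $R\times S$. $\mathbf 1$ is the quantum set whose only atom is $\mathbb C$. The symmetric monoidal category $(\mathbf{qSet},\times,\mathbf 1)$ is closed (known): for quantum sets $\mathcal Y,\mathcal Z$ there are a quantum set $\mathcal Z^{\mathcal Y}$ and a function $\mathrm{Eval}\colon\mathcal Z^{\mathcal Y}\times\mathcal Y\to\mathcal Z$ such that each function $F\colon\mathcal X\times\mathcal Y\to\mathcal Z$ equals $\mathrm{Eval}\circ(G\times I_{\mathcal Y})$ for a unique function $G\colon\mathcal X\to\mathcal Z^{\mathcal Y}$. For an ordinary set $A$, $`A$ is the quantum set with one one-dimensional atom $\mathbb C_a$ for each $a\in A$; for $r\subseteq A\times B$, $`r(\mathbb C_a,\mathbb C_b)=L(\mathbb C_a,\mathbb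 C_b)$ if $(a,b)\in r$ and $0$ otherwise. $\mathbb B=\{0,1\}$ is ordered by $0\sqsubset1$ and $`\mathbb B$ by $`{\sqsubseteq}$. $`1\colon\mathbf 1=`\{\ast\}\to`\mathbb B$ is induced by the function $\{\ast\}\to\mathbb B$ with value $1$. For each quantum set $\mathcal Y$, $F\mapsto`1^\dagger\circ F$ is a bijection from functions $\mathcal Y\to`\mathbb B$ to binary relations from $\mathcal Y$ to $\mathbf 1$ (known), so $\tilde P$ is well defined. The dual $\mathcal X^*$ has as atoms the duals $X^*=L(X,\mathbb C)$ of the atoms $X$ of $\mathcal X$. $E_{\mathcal X}$ is the binary relation from $\mathcal X\times\mathcal X^*$ to $\mathbf 1$ with $E_{\mathcal X}(X\otimes X^*,\mathbb C)=\mathbb C\,\epsilon_X$, where $\epsilon_X\colon X\otimes X^*\to\mathbb C$ is the evaluation pairing, and all other components zero. $[\mathcal X^*,`\mathbb B]_{\sqsubseteq}$ is the internal hom in $\mathbf{qPOS}$ from $(\mathcal X^*,I_{\mathcal X^*})$ to $(`\mathbb B,`{\sqsubseteq})$, with evaluation $\mathrm{Eval}_{\sqsubseteq}$. Concretely, its underlying quantum set is $(`\mathbb B)^{\mathcal X^*}$, $\mathrm{Eval}_{\sqsubseteq}=\mathrm{Eval}$, and its order is the largest binary relation $Q$ on $(`\mathbb B)^{\mathcal X^*}$ such that $\mathrm{Eval}\circ(Q\times I_{\mathcal X^*})\le`{\sqsubseteq}\circ\mathrm{Eval}$. *)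

(* Defs.v *)
From HB Require Import structures.
From mathcomp Require Import all_boot all_order all_algebra.
From mathcomp Require Import sesquilinear complex.
From mathcomp Require Import boolp reals.

Set Implicit Arguments.
Unset Strict Implicit.
Unset Printing Implicit Defensive.

Import Order.TTheory GRing.Theory Num.Theory Num.Def.

Local Open Scope ring_scope.

(* A finite-dimensional Hilbert space; hdot is linear in its first argument. *)
Record hilbert (C : numClosedFieldType) := Hilbert {
  hvect :> vectType C;
  hdot : {dot hvect for (@conjC C)} }.

Notation "''[' u , v ]" := (hdot _ u v) : ring_scope.

Section OrthonormalBasis.
Variable C : numClosedFieldType.
Implicit Types X Y Z : hilbert C.

Lemma orthonormal_basis_exists X :
  exists e : (dim X).-tuple X, orthonormal (hdot X) e.
Proof.
suff [s ss os] : exists2 s : seq X, size s == dim X & orthonormal (hdot X) s.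
  by exists (Tuple ss).
have: (dim X <= dim X)%N by [].
elim: {1 3}(dim X) => [|n IH] ltn; first by exists [::].
have [s /eqP ss os] := IH (ltnW ltn).
have [v vNs] : exists v, v \notin <<s>>%VS.
  have /subvPn[v _ vs] : ~~ ({:X} <= <<s>>)%VS; last by exists v.
  apply: contraL ltn => /dimvS; rewrite dimvf => le; rewrite -leqNgt -ss.
  exact: leq_trans le (dim_span s).
have [x xs [y [vE _ oys]]] := orthogonal_split (hdot X) s v.
have y0 : y != 0 by apply: contraNneq vNs => y0; rewrite vE y0 addr0.
exists ((sqrtC '[y, y])^-1 *: y :: s); first by rewrite /= ss.
rewrite -cat1s orthonormal_cat os; apply/and3P; split=> //.
  rewrite /orthonormal /= dnormZ normfV ger0_norm ?sqrtC_ge0 ?dnorm_ge0 //.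
  by rewrite exprVn sqrtCK mulVf ?eqxx // dnorm_eq0.
apply/(orthogonalP (form := hdot X)) => u z; rewrite inE => /eqP -> zs.
rewrite linearZl_LR /=; have -> : '[y, z] = 0 by apply: (orthogonalP oys); rewrite ?mem_head.
by rewrite mulr0.
Qed.

Definition onb X (i : 'I_(dim X)) : X :=
  tnth (xchoose (orthonormal_basis_exists X)) i.

Lemma onbP X (i j : 'I_(dim X)) : '[onb i, onb j] = (i == j)%:R.
Proof.
have /orthonormalP[ut oe] := xchooseP (orthonormal_basis_exists X).
rewrite oe ?mem_tnth // /onb !(tnth_nth 0) nth_uniq ?size_tuple //.
Qed.

Lemma onb_sum X (x : X) : x = \sum_i '[x, onb i] *: onb i.
Proof.
have oe := xchooseP (orthonormal_basis_exists X).
have fe := orthonormal_free oe.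
have be : basis_of {:X} (xchoose (orthonormal_basis_exists X)).
  by rewrite basisEfree fe subvf size_tuple dimvf /=.
have /coord_span xE : x \in <<xchoose (orthonormal_basis_exists X)>>%VS.
  by rewrite (span_basis be) memvf.
rewrite [LHS]xE; apply: eq_bigr => i _; rewrite -tnth_nth -/(onb i).
congr (_ *: _); rewrite [in RHS]xE linear_sumlz (bigD1 i) //= big1 => [|j ji].
  by rewrite -tnth_nth linearZl_LR /= onbP eqxx mulr1 addr0.
by rewrite -tnth_nth linearZl_LR /= onbP (negPf ji) mulr0.
Qed.

Lemma hdot_sum X (x y : X) : '[x, y] = \sum_i '[x, onb i] * conjC '[y, onb i].
Proof.
rewrite [in LHS](onb_sum y) linear_sumr; apply: eq_bigr => i _.
by rewrite linearZr_LR /= mulrC.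
Qed.

Lemma hdotC X (x y : X) : '[x, y] = conjC '[y, x].
Proof. by rewrite hermC expr0 mul1r. Qed.

Lemma hdot_inj X (x y : X) : (forall z, '[z, x] = '[z, y]) -> x = y.
Proof.
move=> xy; apply/eqP; rewrite -subr_eq0 -(dnorm_eq0 (hdot X)).
by rewrite linearBr /= xy subrr.
Qed.

End OrthonormalBasis.

(* hom_dot f g is the Hilbert-Schmidt inner product tr (g^dagger f), which does
   not depend on the basis. *)
Section HomHilbert.
Variables (C : numClosedFieldType) (X Y : hilbert C).

Definition hom_dot (f g : 'Hom(X, Y)) : C := \sum_i '[f (onb i), g (onb i)].

Fact hom_dot_bilinear : bilinear_for
  (GRing.Scale.Law.clone _ _ *%R _) (GRing.Scale.Law.clone _ _ (conjC \; *%R) _)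
  hom_dot.
Proof.
split=> [g|f] a u v /=; rewrite /hom_dot mulr_sumr -big_split; apply: eq_bigr => i _.
  by rewrite add_lfunE scale_lfunE linearPl.
by rewrite add_lfunE scale_lfunE linearPr.
Qed.

HB.instance Definition _ := bilinear_isBilinear.Build _ _ _ _ _ _ hom_dot
  hom_dot_bilinear.

Fact hom_dot_herm (f g : 'Hom(X, Y)) : hom_dot f g = (-1) ^+ false * conjC (hom_dot g f).
Proof.
by rewrite expr0 mul1r rmorph_sum; apply: eq_bigr => i _; apply: hdotC.
Qed.

HB.instance Definition _ := isHermitianSesquilinear.Build _ _ false (@conjC C)
  hom_dot hom_dot_herm.

Fact hom_dot_gt0 (f : 'Hom(X, Y)) : f != 0 -> 0 < hom_dot f f.
Proof.
move=> f0; rewrite lt_def sumr_ge0 ?andbT => [|i _]; last exact: dnorm_ge0.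
apply: contra_neq f0 => fE; apply/lfunP => x; rewrite lfunE /= (onb_sum x).
rewrite linear_sum big1 // => i _; rewrite linearZ /=.
have /psumr_eq0P/(_ fE i isT)/eqP : forall j, true -> 0 <= '[f (onb j), f (onb j)].
  by move=> j _; apply: dnorm_ge0.
by rewrite dnorm_eq0 => /eqP ->; rewrite scaler0.
Qed.

HB.instance Definition _ := isDotProduct.Build _ _ hom_dot hom_dot_gt0.

Definition homh : hilbert C := Hilbert (hom_dot : {dot 'Hom(X, Y) for (@conjC C)}).

Lemma homhE (f g : homh) :
  '[f, g] = \sum_i '[(f : 'Hom(X, Y)) (onb i), (g : 'Hom(X, Y)) (onb i)].
Proof. by []. Qed.

End HomHilbert.

Section Ground.
Variable C : numClosedFieldType.

Definition ground_dot (x y : C^o) : C := x * conjC y.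

Fact ground_dot_bilinear : bilinear_for
  (GRing.Scale.Law.clone _ _ *%R _) (GRing.Scale.Law.clone _ _ (conjC \; *%R) _)
  ground_dot.
Proof.
split=> [y|x] a u v /=; rewrite /ground_dot.
  by rewrite mulrDl -scalerAl.
by rewrite rmorphD mulrDr [a *: u]/(a * u) rmorphM /= mulrCA.
Qed.

HB.instance Definition _ := bilinear_isBilinear.Build _ _ _ _ _ _ ground_dot
  ground_dot_bilinear.

Fact ground_dot_herm (x y : C^o) :
  ground_dot x y = (-1) ^+ false * conjC (ground_dot y x).
Proof. by rewrite expr0 mul1r rmorphM /= conjCK mulrC. Qed.

HB.instance Definition _ := isHermitianSesquilinear.Build _ _ false (@conjC C)
  ground_dot ground_dot_herm.

Fact ground_dot_gt0 (x : C^o) : x != 0 -> 0 < ground_dot x x.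
Proof. by move=> x0; rewrite /ground_dot -normCK exprn_gt0 ?normr_gt0. Qed.

HB.instance Definition _ := isDotProduct.Build _ _ ground_dot ground_dot_gt0.

Definition ground : hilbert C := Hilbert (ground_dot : {dot C^o for (@conjC C)}).

Lemma groundE (x y : ground) : '[x, y] = (x : C) * conjC (y : C).
Proof. by []. Qed.

End Ground.

Section LinfunE.
Variables (C : fieldType) (U V : vectType C).

Lemma linfunE (f : U -> V) : linear f -> linfun f =1 f.
Proof.
move=> lf; pose g : {linear U -> V} := HB.pack f (GRing.isLinear.Build _ _ _ _ f lf).
exact: (lfunE g).
Qed.

End LinfunE.

Section Operators.
Variable C : numClosedFieldType.
Implicit Types X Y Z : hilbert C.

(* By adjointP, the Hilbert space adjoint, written in the basis onb X. *)
Definition adjoint X Y (f : 'Hom(X, Y)) : 'Hom(Y, X) :=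
  linfun (fun y => \sum_i '[y, f (onb i)] *: onb i).

Lemma adjointE X Y (f : 'Hom(X, Y)) y :
  adjoint f y = \sum_i '[y, f (onb i)] *: onb i.
Proof.
rewrite linfunE // => a u v; rewrite scaler_sumr -big_split; apply: eq_bigr => i _.
by rewrite linearPl scalerDl scalerA.
Qed.

Lemma adjointP X Y (f : 'Hom(X, Y)) x y : '[f x, y] = '[x, adjoint f y].
Proof.
rewrite adjointE linear_sumr [in LHS](onb_sum x) linear_sum linear_sumlz.
apply: eq_bigr => i _; rewrite linearZ /= linearZl_LR linearZr_LR /=.
by rewrite mulrC [in LHS]hdotC.
Qed.

Lemma adjointDZ X Y a (f g : 'Hom(X, Y)) :
  adjoint (a *: f + g) = conjC a *: adjoint f + adjoint g.
Proof.
apply/lfunP => y; apply: hdot_inj => x.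
rewrite -adjointP !add_lfunE !scale_lfunE linearPl linearDr linearZr_LR /= conjCK.
by rewrite -!adjointP.
Qed.

Lemma adjoint0 X Y : adjoint (0 : 'Hom(X, Y)) = 0.
Proof.
apply/lfunP => y; apply: hdot_inj => x.
by rewrite -adjointP !lfunE /= linear0l linear0r.
Qed.

Lemma adjointK X Y : cancel (@adjoint X Y) (@adjoint Y X).
Proof.
move=> f; apply/lfunP => x; apply: hdot_inj => y.
by rewrite -adjointP hdotC -adjointP -hdotC.
Qed.

Definition dualh X : hilbert C := homh X (ground C).

Definition bra X (e : X) : dualh X := linfun (fun x : X => '[x, e] : ground C).

Lemma braE X (e x : X) : (bra e : 'Hom(X, ground C)) x = '[x, e].
Proof. by rewrite linfunE // => a u v; rewrite linearPl. Qed.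

(* The tensor product of X and Y is modelled by L(X^*, Y), where the pure tensor
   of x and y is the operator phi |-> phi(x) y; dot_pure shows that the
   Hilbert-Schmidt inner product is the tensor product one. *)
Definition tensh X Y : hilbert C := homh (dualh X) Y.

Definition pure X Y (x : X) (y : Y) : tensh X Y :=
  linfun (fun phi : dualh X => ((phi : 'Hom(X, ground C)) x : C) *: y).

Lemma pureE X Y (x : X) (y : Y) (phi : dualh X) :
  (pure x y : 'Hom(dualh X, Y)) phi = ((phi : 'Hom(X, ground C)) x : C) *: y.
Proof.
rewrite linfunE // => a u v.
by rewrite add_lfunE scale_lfunE scalerDl scalerA.
Qed.

Lemma pureDZl X Y (y : Y) : linear (fun x : X => pure x y).
Proof.
move=> a u v; apply/lfunP => phi.
by rewrite add_lfunE scale_lfunE !pureE linearP scalerDl scalerA.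
Qed.

Lemma pureDZr X Y (x : X) : linear (fun y : Y => pure x y).
Proof.
move=> a u v; apply/lfunP => phi.
by rewrite add_lfunE scale_lfunE !pureE scalerDr !scalerA mulrC.
Qed.

Lemma tens_sum X Y (t : tensh X Y) :
  t = \sum_i pure (onb i) ((t : 'Hom(dualh X, Y)) (bra (onb i))).
Proof.
apply/lfunP => phi; rewrite sum_lfunE.
under eq_bigr => i _ do rewrite pureE -linearZ /=.
rewrite -linear_sum; congr (fun_of_lfun _ _).
apply/lfunP => x; rewrite sum_lfunE [in LHS](onb_sum x) linear_sum.
apply: eq_bigr => i _; rewrite scale_lfunE braE linearZ /=.
by rewrite [LHS]mulrC.
Qed.

Lemma dot_pure X Y (x x' : X) (y y' : Y) :
  '[pure x y, pure x' y'] = '[x, x'] * '[y, y'].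
Proof.
have ev (phi : dualh X) z : (phi : 'Hom(X, ground C)) z = '[phi, bra z].
  rewrite homhE [in LHS](onb_sum z) linear_sum.
  apply: eq_bigr => i _; rewrite linearZ /= braE groundE.
  by rewrite -hdotC mulrC.
rewrite homhE.
under eq_bigr => i _ do rewrite !pureE linearZl_LR linearZr_LR /= mulrA !ev.
rewrite -mulr_suml; congr (_ * _).
transitivity '[bra x', bra x]; last by rewrite -ev braE.
rewrite hdot_sum; apply: eq_bigr => i _.
by rewrite mulrC; congr (_ * _); [rewrite -hdotC | rewrite hdotC].
Qed.

(* Meaningful for bilinear B only, by tliftE and tens_ext the unique linear map
   that sends pure x y to B x y. *)
Definition tlift X Y Z (B : X -> Y -> Z) : 'Hom(tensh X Y, Z) :=
  linfun (fun t : tensh X Y =>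
    \sum_i B (onb i) ((t : 'Hom(dualh X, Y)) (bra (onb i)))).

Lemma tliftE X Y Z (B : X -> Y -> Z) :
  (forall y, linear (B^~ y)) -> (forall x, linear (B x)) ->
  forall x y, tlift B (pure x y) = B x y.
Proof.
move=> lB rB x y; rewrite linfunE => [|a u v].
  pose g : {linear X -> Z} := HB.pack (B^~ y) (GRing.isLinear.Build _ _ _ _ _ (lB y)).
  rewrite [in RHS](onb_sum x) -[RHS]/(g _) linear_sum; apply: eq_bigr => i _.
  pose h : {linear Y -> Z} :=
    HB.pack (B (onb i)) (GRing.isLinear.Build _ _ _ _ _ (rB (onb i))).
  by rewrite pureE braE linearZ -[LHS]/(h _) linearZ.
rewrite scaler_sumr -big_split; apply: eq_bigr => i _.
by rewrite add_lfunE scale_lfunE rB.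
Qed.

Lemma tens_ext X Y Z (f g : 'Hom(tensh X Y, Z)) :
  (forall x y, f (pure x y) = g (pure x y)) -> f = g.
Proof.
move=> fg; apply/lfunP => t; rewrite (tens_sum t) !linear_sum.
by apply: eq_bigr => i _; apply: fg.
Qed.

Definition tensf X X' Y Y' (f : 'Hom(X, Y)) (g : 'Hom(X', Y')) :
    'Hom(tensh X X', tensh Y Y') :=
  tlift (fun x x' => pure (f x) (g x')).

Lemma tensfE X X' Y Y' (f : 'Hom(X, Y)) (g : 'Hom(X', Y')) x x' :
  tensf f g (pure x x') = pure (f x) (g x').
Proof.
rewrite tliftE // => [y|y] a u v; rewrite linearP; [exact: pureDZl|exact: pureDZr].
Qed.

Definition eval_pairing X : 'Hom(tensh X (dualh X), ground C) :=
  tlift (fun x (phi : dualh X) => (phi : 'Hom(X, ground C)) x).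

Lemma eval_pairingE X (x : X) (phi : dualh X) :
  eval_pairing X (pure x phi) = (phi : 'Hom(X, ground C)) x.
Proof.
rewrite tliftE // => [psi|y] a u v; first exact: linearP.
by rewrite add_lfunE scale_lfunE.
Qed.

End Operators.

(* The linear span of a possibly infinite set of vectors. *)
Section SetSpan.
Variables (K : fieldType) (V : vectType K).

Lemma setspan_exists (P : V -> Prop) : exists s : seq V,
  (forall v, v \in s -> P v) /\ (forall v, P v -> v \in <<s>>%VS).
Proof.
pose good n := exists2 s : seq V, (forall v, v \in s -> P v) & \dim <<s>> = n.
have good0 : exists n, `[< good n >].
  by exists 0%N; apply/asboolP; exists [::]; rewrite // span_nil dimv0.
have goodB n : `[< good n >] -> (n <= dim V)%N.
  by case/asboolP => s _ <-; rewrite -(dimvf V) dimvS ?subvf.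
case: (ex_maxnP good0 goodB) => n /asboolP[s sP sn] nmax.
exists s; split=> // v Pv; apply: contraT => vs.
have /nmax : `[< good (\dim <<v :: s>>) >].
  apply/asboolP; exists (v :: s) => // u.
  by rewrite inE => /orP[/eqP -> //|/sP].
rewrite -sn => le; have ss : (<<s>> <= <<v :: s>>)%VS.
  by apply: sub_span => u us; rewrite inE us orbT.
case/negP: vs; have /eqP -> : <<s>>%VS == <<v :: s>>%VS by rewrite eqEdim ss.
by rewrite memv_span ?mem_head.
Qed.

Definition setspan (P : V -> Prop) : {vspace V} := <<projT1 (cid (setspan_exists P))>>.

Lemma mem_setspan (P : V -> Prop) v : P v -> v \in setspan P.
Proof. exact: (projT2 (cid (setspan_exists P))).2. Qed.

Lemma setspan_ind (P Q : V -> Prop) :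
  Q 0 -> (forall a u v, P u -> Q v -> Q (a *: u + v)) ->
  forall v, v \in setspan P -> Q v.
Proof.
move=> Q0 QP v; rewrite /setspan; case: cid => s [/= sP _].
rewrite -[s]in_tupleE => /coord_span ->.
elim/big_rec: _ => // i u _ Qu; apply: QP => //.
by apply: sP; rewrite mem_nth.
Qed.

Lemma setspan_subvP (P : V -> Prop) (W : {vspace V}) :
  (setspan P <= W)%VS <-> (forall v, P v -> v \in W).
Proof.
split=> [/subvP PW v /mem_setspan /PW // | PW]; apply/subvP.
apply: setspan_ind => [|a u v /PW uW vW]; first exact: mem0v.
by rewrite memvD ?memvZ.
Qed.

End SetSpan.

(* The set of atoms is given as a family of Hilbert spaces indexed by atom. *)
Record qset (C : numClosedFieldType) := QSet {
  atom : Type;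
  hsp : atom -> hilbert C;
  hsp_neq0 : forall a, (0 < \dim {: hsp a})%N }.

Section QuantumSets.
Variable C : numClosedFieldType.
Implicit Types X Y Z W : qset C.

Definition brel X Y := forall (x : atom X) (y : atom Y), {vspace 'Hom(hsp x, hsp y)}.

Definition brel_le X Y (R S : brel X Y) := forall x y, (R x y <= S x y)%VS.

Definition brel_meet X Y (R S : brel X Y) : brel X Y :=
  fun x y => (R x y :&: S x y)%VS.

Definition mulv (U V W : hilbert C)
    (A : {vspace 'Hom(V, W)}) (B : {vspace 'Hom(U, V)}) : {vspace 'Hom(U, W)} :=
  setspan (fun f => exists a b, [/\ a \in A, b \in B & f = (a \o b)%VF]).

Definition brel_comp X Y Z (S : brel Y Z) (R : brel X Y) : brel X Z :=
  fun x z => setspan (fun f => exists y, f \in mulv (S y z) (R x y)).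

(* The set of adjoints is already a subspace, see mem_brel_adj. *)
Definition brel_adj X Y (R : brel X Y) : brel Y X :=
  fun y x => setspan (fun f => exists2 r, r \in R x y & f = adjoint r).

(* The match casts the identity of hsp x along x = y. *)
Definition brel_id X : brel X X := fun x y => setspan (fun f =>
  exists e : x = y, f = match e in _ = y' return 'Hom(hsp x, hsp y') with
                        | erefl => \1%VF
                        end).

Arguments brel_id X : clear implicits.

Definition is_function X Y (F : brel X Y) :=
  brel_le (brel_id X) (brel_comp (brel_adj F) F) /\
  brel_le (brel_comp F (brel_adj F)) (brel_id Y).

Definition is_order X (R : brel X X) :=
  [/\ brel_le (brel_id X) R, brel_le (brel_comp R R) R
    & brel_meet R (brel_adj R) = brel_id X].

Definition monotone X Y (R : brel X X) (S : brel Y Y) (F : brel X Y) :=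
  brel_le (brel_comp F R) (brel_comp S F).

Definition order_embedding X Y (R : brel X X) (S : brel Y Y) (F : brel X Y) :=
  R = brel_comp (brel_adj F) (brel_comp S F).

Fact dim_homh_gt0 (U V : hilbert C) :
  (0 < \dim {:U})%N -> (0 < \dim {:V})%N -> (0 < \dim {: homh U V})%N.
Proof. by rewrite !dimvf muln_gt0 => -> ->. Qed.

Fact dim_ground_gt0 : (0 < \dim {: ground C})%N.
Proof. by rewrite dimvf. Qed.

Definition qprod X Y : qset C :=
  @QSet C (atom X * atom Y) (fun p => tensh (hsp p.1) (hsp p.2))
    (fun p => dim_homh_gt0 (dim_homh_gt0 (hsp_neq0 p.1) dim_ground_gt0) (hsp_neq0 p.2)).

Definition tensv (U U' V V' : hilbert C)
    (A : {vspace 'Hom(U, V)}) (B : {vspace 'Hom(U', V')}) :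
    {vspace 'Hom(tensh U U', tensh V V')} :=
  setspan (fun f => exists a b, [/\ a \in A, b \in B & f = tensf a b]).

Definition brel_prod X X' Y Y' (R : brel X Y) (S : brel X' Y') :
    brel (qprod X X') (qprod Y Y') :=
  fun x y => tensv (R x.1 y.1) (S x.2 y.2).

Definition qdual X : qset C :=
  @QSet C (atom X) (fun x => dualh (hsp x))
    (fun x => dim_homh_gt0 (hsp_neq0 x) dim_ground_gt0).

Definition quote (A : Type) : qset C :=
  @QSet C A (fun=> ground C) (fun=> dim_ground_gt0).

Definition quote_rel (A B : Type) (r : A -> B -> Prop) : brel (quote A) (quote B) :=
  fun a b => if `[< r a b >] then fullv else 0%VS.

Definition qone : qset C := quote unit.

(* quote_true is the function from qone, that is the quote of a one-point set,
   induced by the ordinary map with value true. *)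
Definition quote_true : brel qone (quote bool) := quote_rel (fun _ b => b = true).

Definition quote_bool_le : brel (quote bool) (quote bool) :=
  quote_rel (fun a b : bool => a ==> b).

Definition dual_counit X : brel (qprod X (qdual X)) qone :=
  fun p _ => setspan (fun f => exists e : p.1 = p.2,
    f = match e in _ = y
          return 'Hom(tensh (hsp p.1) (dualh (hsp y)), ground C) with
        | erefl => eval_pairing (hsp p.1)
        end).

Definition is_exponential Y Z (H : qset C) (ev : brel (qprod H Y) Z) :=
  is_function ev /\
  forall X (F : brel (qprod X Y) Z), is_function F ->
    exists! G : brel X H, is_function G /\ brel_comp ev (brel_prod G (brel_id Y)) = F.

(* (H, Q) with evaluation ev is the internal hom in qPOS from (Y, I_Y), the
   trivially ordered Y, to (Z, S): an exponential in qSet with the largest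
   relation that makes ev monotone. *)
Definition is_internal_hom Y Z (S : brel Z Z)
    (H : qset C) (Q : brel H H) (ev : brel (qprod H Y) Z) :=
  let evaluable (Q' : brel H H) :=
    brel_le (brel_comp ev (brel_prod Q' (brel_id Y))) (brel_comp S ev) in
  [/\ is_exponential ev, evaluable Q & forall Q', evaluable Q' -> brel_le Q' Q].

Lemma mem_brel_adj X Y (R : brel X Y) y x (f : 'Hom(hsp y, hsp x)) :
  (f \in brel_adj R y x) = (adjoint f \in R x y).
Proof.
apply/idP/idP => [|fR]; last by apply: mem_setspan; exists (adjoint f); rewrite ?adjointK.
elim/setspan_ind => [|a u v [r rR ->] vR]; first by rewrite adjoint0 mem0v.
by rewrite adjointDZ adjointK memvD ?memvZ.
Qed.

End QuantumSets.

Arguments brel_id {C} X x y : rename.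
Arguments quote C A : clear implicits.
Arguments qone C : clear implicits.
Arguments quote_true C a b : clear implicits, rename.
Arguments quote_bool_le C a b : clear implicits, rename.
Arguments dual_counit {C} X x y : rename.

(* Main.v *)
Require Import Defs.
From mathcomp Require Import all_boot all_order all_algebra.
From mathcomp Require Import complex boolp reals.

(** Classically [P] sends the pair (x, y) to the truth value of y <= x, so its
transpose [G] sends x to the indicator of its lower set, and the theorem says
that x <= x' exactly when the lower set of x is contained in that of x'.  The
proof is this Yoneda argument, carried out in the calculus of relations.

Relations compose associatively, with units and a contravariant involution
given by adjoints, and the Cartesian product is functorial ([compA],
[comp_idl], [adj_comp], [prod_comp], [adj_prod]).  Everything concrete about
Hilbert spaces enters through two facts.

A function [F] into the quoted booleans is determined by its component at
true: the components at true and at false are orthogonal complements of each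
other.  Hence the condition that [F] increases along a relation A, which by its
form speaks of the component at false, amounts to the component at true
absorbing the adjoint of A ([monotone_quote_boolP]).

The counit of the duality bends the output wire of an operator into an input
wire, and bending is injective; so comparing relations after pairing them with
the counit is the same as comparing them ([counit_prod_le]).

Combining both, for every relation S on [X], the function [P] increases along S
if and only if S o ord <= ord ([monotone_lower_setP]).  Taking S = ord, this is
transitivity and gives the monotonicity of [P].  The transpose [G] of [P] is
then monotone, because G o ord o G^dagger is a relation along which evaluation
increases, hence lies below [Q], the largest one ([transpose_monotone]).
Conversely [P] increases along S = G^dagger o Q o G ([transpose_pullback]), so
S <= S o ord <= ord by reflexivity; the opposite inclusion ord <= S follows
from the monotonicity of [G] and I <= G^dagger o G.  Uniqueness of [G] is that of the exponential transpose. *)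

Set Implicit Arguments.
Unset Strict Implicit.
Unset Printing Implicit Defensive.

Import Order.TTheory GRing.Theory Num.Theory Num.Def.

Local Open Scope ring_scope.

Declare Scope brel_scope.
Local Notation "R <=b S" := (brel_le R S) (at level 70) : brel_scope.
Local Notation "S \ob R" := (brel_comp S R) (at level 50, left associativity)
  : brel_scope.
Local Notation "R ^b" := (brel_adj R) (at level 3, format "R ^b") : brel_scope.
Local Notation "R \xb S" := (brel_prod R S) (at level 40, left associativity)
  : brel_scope.
Local Open Scope brel_scope.

(** * Induction over linear spans *)

Section LinearClosure.
Variable K : fieldType.

(** Arbitrary predicates are allowed, rather than subspaces, because spans are
also pushed through the adjoint, which is only conjugate-linear, and through
images of linear maps. *)
Definition lin_closed (V : vectType K) (Q : V -> Prop) :=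
  Q 0 /\ forall a u v, Q u -> Q v -> Q (a *: u + v).

Lemma lin_closed_comp (U V : vectType K) (Q : V -> Prop) (phi : U -> V) :
  lin_closed Q -> linear phi -> lin_closed (fun u => Q (phi u)).
Proof.
move=> [Q0 QD] lphi; split=> [|a u v Qu Qv]; last by rewrite lphi; apply: QD.
(* Linearity at this combination yields phi 0 = - phi 0 + phi 0. *)
have -> : 0 = -1 *: 0 + 0 :> U by rewrite scaler0 addr0.
by rewrite lphi scaleN1r addNr.
Qed.

Lemma lin_closed_mem (V : vectType K) (W : {vspace V}) :
  lin_closed (fun v => v \in W).
Proof. by split=> [|a u v uW vW]; rewrite ?mem0v ?memvD ?memvZ. Qed.

Lemma lin_closed_preim (U V : vectType K) (phi : U -> V) (W : {vspace V}) :
  linear phi -> lin_closed (fun u => phi u \in W).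
Proof. exact: lin_closed_comp (lin_closed_mem W). Qed.

Lemma setspan_lin_ind (V : vectType K) (P Q : V -> Prop) :
  lin_closed Q -> (forall v, P v -> Q v) -> forall v, v \in setspan P -> Q v.
Proof.
by case=> Q0 QD PQ; apply: setspan_ind => // a u v /PQ Qu Qv; apply: QD.
Qed.

End LinearClosure.

(** * Adjoints, tensor products and the evaluation pairing *)

Section Operators.
Variable C : numClosedFieldType.
Implicit Types U V W : hilbert C.

Lemma comp_lfun_linl U V W (r : 'Hom(U, V)) :
  linear (fun s : 'Hom(V, W) => (s \o r)%VF).
Proof. by move=> a s s'; rewrite comp_lfunDl comp_lfunZl. Qed.

Lemma comp_lfun_linr U V W (s : 'Hom(V, W)) :
  linear (fun r : 'Hom(U, V) => (s \o r)%VF).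
Proof. by move=> a r r'; rewrite comp_lfunDr comp_lfunZr. Qed.

Lemma lin_closed_adjoint U V (A : {vspace 'Hom(V, U)}) :
  lin_closed (fun f : 'Hom(U, V) => adjoint f \in A).
Proof.
split=> [|a u v uA vA]; first by rewrite adjoint0 mem0v.
by rewrite adjointDZ memvD ?memvZ.
Qed.

Lemma adjoint_comp U V W (s : 'Hom(V, W)) (r : 'Hom(U, V)) :
  adjoint (s \o r)%VF = (adjoint r \o adjoint s)%VF.
Proof.
apply/lfunP => z; apply: hdot_inj => x.
by rewrite -adjointP !comp_lfunE /= !adjointP.
Qed.

Lemma adjoint_id U : adjoint (\1%VF : 'Hom(U, U)) = \1%VF.
Proof.
by apply/lfunP => z; apply: hdot_inj => x; rewrite -adjointP !lfunE.
Qed.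

Lemma tensf_linl U U' V V' (g : 'Hom(U', V')) :
  linear (fun f : 'Hom(U, V) => tensf f g).
Proof.
move=> a f f'; apply: tens_ext => x y; rewrite add_lfunE scale_lfunE !tensfE.
by rewrite add_lfunE scale_lfunE pureDZl.
Qed.

Lemma tensf_linr U U' V V' (f : 'Hom(U, V)) :
  linear (fun g : 'Hom(U', V') => tensf f g).
Proof.
move=> a g g'; apply: tens_ext => x y; rewrite add_lfunE scale_lfunE !tensfE.
by rewrite add_lfunE scale_lfunE pureDZr.
Qed.

Lemma tensf_comp U U' V V' W W' (s : 'Hom(V, W)) (r : 'Hom(U, V))
    (s' : 'Hom(V', W')) (r' : 'Hom(U', V')) :
  tensf (s \o r)%VF (s' \o r')%VF = (tensf s s' \o tensf r r')%VF.
Proof. by apply: tens_ext => x y; rewrite comp_lfunE !tensfE !comp_lfunE. Qed.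

Lemma tensf_id U V : tensf (\1%VF : 'Hom(U, U)) (\1%VF : 'Hom(V, V)) = \1%VF.
Proof. by apply: tens_ext => x y; rewrite tensfE !lfunE. Qed.

Lemma hdot_tens_inj U V (t t' : tensh U V) :
  (forall x y, hdot _ (pure x y) t = hdot _ (pure x y) t') -> t = t'.
Proof.
move=> tt'; apply: hdot_inj => z; rewrite (tens_sum z) !linear_sumlz.
by apply: eq_bigr => i _; apply: tt'.
Qed.

Lemma adjoint_tensf U U' V V' (f : 'Hom(U, V)) (g : 'Hom(U', V')) :
  adjoint (tensf f g) = tensf (adjoint f) (adjoint g).
Proof.
apply: tens_ext => x y; apply: hdot_tens_inj => u v.
by rewrite -adjointP !tensfE !dot_pure !adjointP.
Qed.

Lemma dualh_separates U (x y : U) :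
  (forall phi : dualh U, (phi : 'Hom(U, ground C)) x = (phi : 'Hom(U, ground C)) y) ->
  x = y.
Proof.
move=> xy; apply: hdot_inj => z; rewrite hdotC [RHS]hdotC.
by have := xy (bra z); rewrite !braE => ->.
Qed.

(** The operator f with its output wire bent around to become an input: a vector
x and a functional phi are sent to phi (f x). *)
Definition bend U V (f : 'Hom(U, V)) : 'Hom(tensh U (dualh V), ground C) :=
  (eval_pairing V \o tensf f (\1 : 'End(dualh V)))%VF.

Lemma bendE U V (f : 'Hom(U, V)) x (phi : dualh V) :
  bend f (pure x phi) = (phi : 'Hom(V, ground C)) (f x).
Proof. by rewrite /bend comp_lfunE tensfE eval_pairingE id_lfunE. Qed.

Lemma bend_linear U V : linear (@bend U V).
Proof. by move=> a f g; rewrite /bend tensf_linl comp_lfun_linr. Qed.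

Lemma bend0 U V : bend (0 : 'Hom(U, V)) = 0.
Proof. by apply: tens_ext => x phi; rewrite bendE !zero_lfunE linear0. Qed.

Lemma bend_inj U V : injective (@bend U V).
Proof.
move=> f g fg; apply/lfunP => x; apply: dualh_separates => phi.
by rewrite -!bendE fg.
Qed.

Lemma ground_endo (s : 'Hom(ground C, ground C)) : exists c : C, s = c *: \1%VF.
Proof.
exists (s (1 : C^o)); apply/lfunP => x; rewrite scale_lfunE id_lfunE.
have -> : x = (x : C) *: (1 : C^o) by rewrite /GRing.scale /= mulr1.
by rewrite linearZ /= [in LHS]/GRing.scale [in RHS]/GRing.scale /= mulr1 mulrC.
Qed.

End Operators.

(** * The calculus of relations between quantum sets *)

Section RelationCalculus.
Variable C : numClosedFieldType.
Implicit Types X Y Z W : qset C.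

Lemma brel_le_refl X Y (R : brel X Y) : R <=b R.
Proof. by move=> x y; apply: subvv. Qed.

Lemma brel_le_trans X Y (S R T : brel X Y) : R <=b S -> S <=b T -> R <=b T.
Proof. by move=> RS ST x y; apply: subv_trans (RS x y) (ST x y). Qed.

Lemma brel_le_anti X Y (R S : brel X Y) : R <=b S -> S <=b R -> R = S.
Proof.
move=> RS SR; apply/functional_extensionality_dep => x.
apply/functional_extensionality_dep => y.
by apply/eqP; rewrite eqEsubv RS SR.
Qed.

Lemma mem_comp X Y Z (S : brel Y Z) (R : brel X Y) x y z s r :
  s \in S y z -> r \in R x y -> (s \o r)%VF \in (S \ob R) x z.
Proof.
move=> sS rR; apply: mem_setspan; exists y.
by apply: mem_setspan; exists s, r.
Qed.

Lemma comp_ind X Y Z (S : brel Y Z) (R : brel X Y) x z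
    (Q : 'Hom(hsp x, hsp z) -> Prop) :
  lin_closed Q ->
  (forall y s r, s \in S y z -> r \in R x y -> Q (s \o r)%VF) ->
  forall f, f \in (S \ob R) x z -> Q f.
Proof.
move=> lQ QSR; apply: setspan_lin_ind => // f [y]; move: f.
by apply: setspan_lin_ind => // f [s [r [sS rR ->]]]; apply: QSR sS rR.
Qed.

Lemma comp_leP X Y Z (S : brel Y Z) (R : brel X Y) (T : brel X Z) :
  S \ob R <=b T <->
  (forall x y z s r, s \in S y z -> r \in R x y -> (s \o r)%VF \in T x z).
Proof.
split=> [le x y z s r sS rR|le x z].
  exact: subvP (le x z) _ (mem_comp sS rR).
apply/subvP; apply: comp_ind => [|y s r]; last exact: le.
exact: lin_closed_mem.
Qed.

Lemma comp_le X Y Z (S S' : brel Y Z) (R R' : brel X Y) :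
  S <=b S' -> R <=b R' -> S \ob R <=b S' \ob R'.
Proof.
move=> SS RR; apply/comp_leP => x y z s r sS rR.
by apply: mem_comp; [apply: subvP sS|apply: subvP rR].
Qed.

Lemma compA X Y Z W (T : brel Z W) (S : brel Y Z) (R : brel X Y) :
  T \ob (S \ob R) = T \ob S \ob R.
Proof.
apply: brel_le_anti; apply/comp_leP; [move=> x z w t u tT; move: u | move=> x y w u r uTS rR].
  apply: comp_ind => [|y s r sS rR].
    by apply: lin_closed_preim; apply: comp_lfun_linr.
  by rewrite comp_lfunA; apply: mem_comp => //; apply: mem_comp.
move: u uTS; apply: comp_ind => [|z t s tT sS].
  by apply: lin_closed_preim; apply: comp_lfun_linl.
by rewrite -comp_lfunA; apply: mem_comp => //; apply: mem_comp.
Qed.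

Lemma mem_id X (x : atom X) : (\1%VF : 'Hom(hsp x, hsp x)) \in brel_id X x x.
Proof. by apply: mem_setspan; exists erefl. Qed.

(** Elimination of the cast in the identity relation: a family of closed
predicates, indexed by the target atom, need only be checked at the identity
operator. *)
Lemma id_ind X (x : atom X) (Q : forall y, 'Hom(hsp x, hsp y) -> Prop) :
  (forall y, lin_closed (Q y)) -> Q x \1%VF ->
  forall y f, f \in brel_id X x y -> Q y f.
Proof.
by move=> lQ Q1 y; apply: setspan_lin_ind (lQ y) _ => f [e ->] {f}; case: y / e.
Qed.

Lemma comp_idl X Y (R : brel X Y) : brel_id Y \ob R = R.
Proof.
apply: brel_le_anti => [|x y].
  apply/comp_leP => x y z i r iI rR.
  move: z i iI; apply: id_ind => [z|]; last by rewrite comp_lfun1l.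
  by apply: lin_closed_preim; apply: comp_lfun_linl.
by apply/subvP => r rR; rewrite -[r]comp_lfun1l; apply: mem_comp => //; apply: mem_id.
Qed.

Lemma mem_adj X Y (R : brel X Y) x y (f : 'Hom(hsp x, hsp y)) :
  f \in R x y -> adjoint f \in R^b y x.
Proof. by rewrite mem_brel_adj adjointK. Qed.

Lemma adjK X Y (R : brel X Y) : R^b^b = R.
Proof.
by apply: brel_le_anti => x y; apply/subvP => f; rewrite !mem_brel_adj adjointK.
Qed.

Lemma adj_le X Y (R S : brel X Y) : R <=b S -> R^b <=b S^b.
Proof.
by move=> RS y x; apply/subvP => f; rewrite !mem_brel_adj; apply: subvP (RS x y) _.
Qed.

Lemma adj_leE X Y (R S : brel X Y) : R^b <=b S^b <-> R <=b S.
Proof. by split=> [/adj_le|/adj_le //]; rewrite !adjK. Qed.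

(** One inclusion, for all relations, suffices: applied to the adjoint relations
it turns, by involutivity, into the other one.  The same device proves
[adj_id] and [adj_prod]. *)
Lemma adj_comp X Y Z (S : brel Y Z) (R : brel X Y) : (S \ob R)^b = R^b \ob S^b.
Proof.
have le X' Y' Z' (B : brel Y' Z') (A : brel X' Y') : A^b \ob B^b <=b (B \ob A)^b.
  apply/comp_leP => z y x r s; rewrite !mem_brel_adj => rA sB.
  by rewrite adjoint_comp; apply: mem_comp.
by apply: brel_le_anti => //; apply/adj_leE; rewrite adjK -{1}[R]adjK -{1}[S]adjK.
Qed.

Lemma adj_id X : (brel_id X)^b = brel_id X.
Proof.
suff le : (brel_id X)^b <=b brel_id X.
  by apply: brel_le_anti => //; move/adj_le: le; rewrite adjK.
move=> y x; apply/subvP => f; rewrite mem_brel_adj -[f in f \in brel_id X _ _]adjointK.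
move: (adjoint f); move: y {f}.
apply: (id_ind (Q := fun y g => adjoint g \in brel_id X y x)) => [y|].
  exact: lin_closed_adjoint.
by rewrite adjoint_id; apply: mem_id.
Qed.

Lemma mem_prod X X' Y Y' (R : brel X Y) (S : brel X' Y') x x' y y' r s :
  r \in R x y -> s \in S x' y' -> tensf r s \in (R \xb S) (x, x') (y, y').
Proof. by move=> rR sS; apply: mem_setspan; exists r, s. Qed.

Lemma prod_ind X X' Y Y' (R : brel X Y) (S : brel X' Y') p q
    (Q : 'Hom(tensh (hsp p.1) (hsp p.2), tensh (hsp q.1) (hsp q.2)) -> Prop) :
  lin_closed Q ->
  (forall r s, r \in R p.1 q.1 -> s \in S p.2 q.2 -> Q (tensf r s)) ->
  forall f, f \in (R \xb S) p q -> Q f.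
Proof.
by move=> lQ QRS; apply: setspan_lin_ind => // f [r [s [rR sS ->]]]; apply: QRS.
Qed.

Lemma prod_leP X X' Y Y' (R : brel X Y) (S : brel X' Y')
    (T : brel (qprod X X') (qprod Y Y')) :
  R \xb S <=b T <->
  (forall x x' y y' r s, r \in R x y -> s \in S x' y' ->
     tensf r s \in T (x, x') (y, y')).
Proof.
split=> [le x x' y y' r s rR sS|le [x x'] [y y']].
  exact: subvP (le _ _) _ (mem_prod rR sS).
apply/subvP; apply: prod_ind => [|r s]; last exact: le.
exact: lin_closed_mem.
Qed.

Lemma prod_le X X' Y Y' (R R' : brel X Y) (S S' : brel X' Y') :
  R <=b R' -> S <=b S' -> R \xb S <=b R' \xb S'.
Proof.
move=> RR SS; apply/prod_leP => x x' y y' r s rR sS.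
by apply: mem_prod; [apply: subvP rR|apply: subvP sS].
Qed.

Lemma prod_comp X X' Y Y' Z Z' (S : brel Y Z) (R : brel X Y)
    (S' : brel Y' Z') (R' : brel X' Y') :
  (S \ob R) \xb (S' \ob R') = (S \xb S') \ob (R \xb R').
Proof.
apply: brel_le_anti.
  apply/prod_leP => x x' z z' f f' fSR fSR'; move: f fSR.
  apply: comp_ind => [|y s r sS rR].
    by apply: lin_closed_preim; apply: tensf_linl.
  move: f' fSR'; apply: comp_ind => [|y' s' r' sS' rR'].
    by apply: lin_closed_preim; apply: tensf_linr.
  by rewrite tensf_comp; apply: (mem_comp (Y := qprod Y Y') (y := (y, y'))); apply: mem_prod.
apply/comp_leP => [[x x'] [y y'] [z z'] f g fS gR]; move: f fS.
apply: prod_ind => [|s s' sS sS'].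
  by apply: lin_closed_preim; apply: comp_lfun_linl.
move: g gR; apply: prod_ind => [|r r' rR rR'].
  by apply: lin_closed_preim; apply: comp_lfun_linr.
by rewrite -tensf_comp; apply: mem_prod; apply: mem_comp.
Qed.

Lemma prod_comp_id X Y Z W (S : brel Y Z) (R : brel X Y) :
  (S \ob R) \xb brel_id W =
  (S \xb brel_id W) \ob (R \xb brel_id W).
Proof. by rewrite -prod_comp comp_idl. Qed.

Lemma comp_idr X Y (R : brel X Y) : R \ob brel_id X = R.
Proof. by rewrite -[LHS]adjK adj_comp adj_id comp_idl adjK. Qed.

Lemma prod_id_le X Y : brel_id X \xb brel_id Y <=b brel_id (qprod X Y).
Proof.
apply/prod_leP => x x' y y' r s rI sI; move: y r rI.
apply: (id_ind (Q := fun y r => tensf r s \in brel_id (qprod X Y) (x, x') (y, y'))).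
  by move=> y; apply: lin_closed_preim; apply: tensf_linl.
move: y' s sI.
apply: (id_ind (Q := fun y' s => tensf \1%VF s \in brel_id (qprod X Y) (x, x') (x, y'))).
  by move=> y; apply: lin_closed_preim; apply: tensf_linr.
by rewrite tensf_id; apply: mem_id.
Qed.

Lemma adj_prod X X' Y Y' (R : brel X Y) (S : brel X' Y') :
  (R \xb S)^b = R^b \xb S^b.
Proof.
have le Z Z' W W' (A : brel Z W) (B : brel Z' W') : A^b \xb B^b <=b (A \xb B)^b.
  apply/prod_leP => y y' x x' r s; rewrite !mem_brel_adj => rA sB.
  by rewrite -[tensf r s]adjointK; apply: mem_adj; rewrite adjoint_tensf; apply: mem_prod.
by apply: brel_le_anti => //; apply/adj_leE; rewrite adjK -{1}[R]adjK -{1}[S]adjK.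
Qed.

(** The counit only sees the diagonal atoms, and the identity on the dual forces
the dual index to stay put; what remains is the bending of the operators of
[A].  No span is needed on the right because bending is linear. *)
Lemma mem_counit_prod X (A : brel X X) (p : atom (qprod X (qdual X)))
    (u : atom (qone C)) (f : 'Hom(hsp p, hsp u)) :
  f \in (dual_counit X \ob (A \xb brel_id (qdual X))) p u <->
  exists2 a, a \in A p.1 p.2 & f = bend a.
Proof.
case: p f => x y f; split=> [|[a aA ->]]; last first.
  apply: (mem_comp (Y := qprod X (qdual X)) (y := (y, y))); last first.
    by apply: mem_prod => //; apply: mem_id.
  by apply: mem_setspan; exists erefl.
(* The predicate is fixed beforehand because its type reduces to a tensor
   product, from which the pair of atoms could not be recovered. *)
pose Q (g : 'Hom(hsp ((x, y) : atom (qprod X (qdual X))), hsp u)) :=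
  exists2 a, a \in A x y & g = bend a.
have lQ : lin_closed Q.
  split=> [|c _ _ [a aA ->] [b bA ->]]; first by exists 0; rewrite ?mem0v ?bend0.
  by exists (c *: a + b); rewrite ?memvD ?memvZ // bend_linear.
move: f; apply: (comp_ind (Q := Q)) => // -[x' y'] e g eE; move: g.
apply: (prod_ind (p := (x, y)) (q := (x', y')) (Q := fun g => Q (e \o g)%VF)) => [|a i aA].
  by apply: lin_closed_comp lQ _; apply: comp_lfun_linr.
move: i; apply: setspan_lin_ind => [|i [+ ->]].
  apply: (lin_closed_comp (Q := fun g => Q (e \o g)%VF)); last exact: tensf_linr.
  by apply: lin_closed_comp lQ _; apply: comp_lfun_linr.
move=> /= yy'; case: y' / yy' e eE a aA {i} => e eE a aA; move: e eE.
apply: setspan_lin_ind => [|e [/= xx' ->] {e}].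
  by apply: lin_closed_comp lQ _; apply: comp_lfun_linl.
case: y / xx' @Q {lQ} a aA => Q a aA.
by exists a.
Qed.

(** Pairing with the counit reflects the order: a bent operator of [A] is a bent
operator of [B], and bending is injective. *)
Lemma counit_prod_le X (A B : brel X X) :
  dual_counit X \ob (A \xb brel_id (qdual X)) <=b
  dual_counit X \ob (B \xb brel_id (qdual X)) <-> A <=b B.
Proof.
split=> [le x y|AB]; last first.
  by apply: comp_le; [apply: brel_le_refl|apply: prod_le => //; apply: brel_le_refl].
apply/subvP => a aA.
have /(subvP (le (x, y) tt)) : bend a \in
  (dual_counit X \ob (A \xb brel_id (qdual X))) (x, y) tt.
  by apply/mem_counit_prod; exists a.
by move/mem_counit_prod => [b bB /bend_inj ->].
Qed.

End RelationCalculus.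

(** * Functions into the quoted booleans *)

Section QuotedBooleans.
Variables (C : numClosedFieldType) (Y : qset C) (F : brel Y (quote C bool)).
Implicit Types (A : brel Y Y) (b : bool).

Definition fiber_stable b A := forall y y' f a,
  f \in F y' b -> a \in A y y' -> (f \o a)%VF \in F y b.

(** Operators on the ground field are scalars, so components of a relation into a
quoted set absorb them. *)
Lemma fiber_ground b y (s : 'Hom(ground C, ground C)) (f : 'Hom(hsp y, ground C)) :
  f \in F y b -> (s \o f)%VF \in F y b.
Proof.
by have [c ->] := ground_endo s; rewrite -comp_lfunZl comp_lfun1l; apply: memvZ.
Qed.

Lemma mem_true_fiber y (u : atom (qone C)) (f : 'Hom(hsp y, hsp u)) :
  f \in ((quote_true C)^b \ob F) y u <-> f \in F y true.
Proof.
split=> [|fF].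
  move: f; apply: comp_ind => [|b s f]; first exact: lin_closed_mem.
  rewrite mem_brel_adj /quote_true /quote_rel; case: asboolP => [->|_].
    by move=> _; apply: fiber_ground.
  rewrite memv0 => /eqP s0 _; rewrite -[s]adjointK s0 adjoint0 comp_lfun0l.
  exact: mem0v.
rewrite -[f]comp_lfun1l; apply: (mem_comp (Y := quote C bool) (y := true)) => //.
by rewrite mem_brel_adj /quote_true /quote_rel asboolT ?memvf.
Qed.

Lemma bool_le_false y f : f \in (quote_bool_le C \ob F) y false -> f \in F y false.
Proof.
move: f; apply: comp_ind => [|b s f]; first exact: lin_closed_mem.
rewrite /quote_bool_le /quote_rel; case: b s f => s f /=.
  by rewrite asboolF ?inE // memv0 => /eqP -> _; rewrite comp_lfun0l mem0v.
by move=> _; apply: fiber_ground.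
Qed.

Lemma false_bool_le y f : f \in F y false -> f \in (quote_bool_le C \ob F) y false.
Proof.
move=> fF; rewrite -[f]comp_lfun1l.
apply: (mem_comp (Y := quote C bool) (y := false)) => //.
by rewrite /quote_bool_le /quote_rel asboolT ?memvf.
Qed.

Hypothesis funF : is_function F.

(** True is the greatest truth value.  An operator f is inserted before the
identity, which lies in the span of the products g^dagger h because [F] is
total; then f g^dagger is some scalar and h comes from [F]. *)
Lemma bool_le_true y f : f \in (quote_bool_le C \ob F) y true.
Proof.
rewrite -[f]comp_lfun1r; have := subvP (funF.1 y y) _ (mem_id y).
move: \1%VF; apply: comp_ind => [|b g h gF hF].
  by apply: lin_closed_preim; apply: comp_lfun_linr.
rewrite comp_lfunA; apply: (mem_comp (Y := quote C bool) (y := b)) => //.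
by rewrite /quote_bool_le /quote_rel asboolT ?memvf ?implybT.
Qed.

(** Distinct atoms of the codomain are not connected by the identity relation,
and [F] being single-valued makes f g^dagger an element of that relation. *)
Lemma fiber_orth b y f g :
  f \in F y (~~ b) -> g \in F y b -> (f \o adjoint g)%VF = 0.
Proof.
move=> fF gF.
have /(subvP (funF.2 b (~~ b))) := mem_comp fF (mem_adj gF).
move: (f \o adjoint g)%VF; apply: setspan_lin_ind => [|h [e]].
  split=> // a u v -> ->.
  by rewrite scaler0 addr0.
by exfalso; move: e; clear; case: b.
Qed.

(** With [fiber_orth], the two components of [F] are orthogonal complements of
each other.  By totality f = f 1 is a combination of terms f g^dagger h with g
and h in the same component, and those from the component at [b] vanish. *)
Lemma fiber_orthP b y (f : 'Hom(hsp y, ground C)) :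
  (forall g, g \in F y b -> (f \o adjoint g)%VF = 0) -> f \in F y (~~ b).
Proof.
move=> fo; rewrite -[f]comp_lfun1r; have := subvP (funF.1 y y) _ (mem_id y).
move: \1%VF; apply: comp_ind => [|c g h].
  by apply: lin_closed_preim; apply: comp_lfun_linr.
rewrite mem_brel_adj comp_lfunA => gF hF.
have [e|ne] := c =P b.
  by subst c; rewrite -[g]adjointK (fo _ gF) comp_lfun0l mem0v.
have -> : ~~ b = c by move: ne; clear; case: b c => [] [].
exact: fiber_ground.
Qed.

(** A subspace is invariant under an operator if and only if its orthogonal
complement is invariant under the adjoint. *)
Lemma fiber_stable_adj b A : fiber_stable b A -> fiber_stable (~~ b) A^b.
Proof.
move=> st y y' f a fF aA; apply: fiber_orthP => g gF.
rewrite -comp_lfunA -[a]adjointK -adjoint_comp; apply: fiber_orth fF _.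
by apply: st => //; rewrite -mem_brel_adj.
Qed.

(** Below false there is only false, and below true there is everything, so
monotonicity along [A] is a condition on the component at false; passing to the
orthogonal complement turns it into one on the component at true. *)
Lemma monotone_quote_boolP A :
  monotone A (quote_bool_le C) F <->
  (quote_true C)^b \ob F \ob A^b <=b (quote_true C)^b \ob F.
Proof.
have -> : monotone A (quote_bool_le C) F <-> fiber_stable false A.
  split=> [mono y y' f a fF aA | st].
    by apply: bool_le_false; apply: subvP (mono _ _) _ (mem_comp fF aA).
  apply/comp_leP => y y' [] f a fF aA; first exact: bool_le_true.
  by apply: false_bool_le; apply: st fF aA.
have -> : (quote_true C)^b \ob F \ob A^b <=b (quote_true C)^b \ob F <->
    fiber_stable true A^b.
  split=> [le y y' f a fF aA|st].
    apply/(mem_true_fiber (u := tt)); apply: subvP (le _ _) _ (mem_comp _ aA).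
    by apply/mem_true_fiber.
  apply/comp_leP => y y' u f a /mem_true_fiber fF aA.
  by apply/mem_true_fiber; apply: st fF aA.
by split=> [|/fiber_stable_adj]; [apply: fiber_stable_adj|rewrite adjK].
Qed.

End QuotedBooleans.

(** * The family of lower sets of an order *)

Section QuantumOrder.
Variables (C : numClosedFieldType) (X : qset C) (ord : brel X X)
  (P : brel (qprod X (qdual X)) (quote C bool)).
Hypotheses (funP : is_function P)
  (trueP : (quote_true C)^b \ob P = dual_counit X \ob (ord^b \xb brel_id (qdual X))).

(** Lower sets grow along [S] if and only if y <= x and x S x' imply y <= x'.
The left-hand side unfolds to E (ord^dagger o S^dagger x I) <=
E (ord^dagger x I) with E the counit, which cancels. *)
Lemma monotone_lower_setP (S : brel X X) :
  monotone (S \xb brel_id (qdual X)) (quote_bool_le C) P <-> S \ob ord <=b ord.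
Proof.
have -> := monotone_quote_boolP funP (S \xb brel_id (qdual X)).
rewrite trueP adj_prod adj_id -compA -prod_comp_id -adj_comp.
by have -> := counit_prod_le (S \ob ord)^b ord^b; apply: adj_leE.
Qed.

End QuantumOrder.

(** * Transposes into an internal hom with trivially ordered source *)

Section InternalHom.
Variables (C : numClosedFieldType) (X Y Z H : qset C) (le : brel Z Z) (ord : brel X X)
  (Q : brel H H) (ev : brel (qprod H Y) Z) (G : brel X H).
Hypotheses (funG : is_function G) (homQ : is_internal_hom le Q ev).

(** Evaluation increases along G o ord o G^dagger, since evaluating after [G] is
the given monotone function, and G o G^dagger <= I.  By maximality this relation
lies below [Q], and precomposing with [G] and using I <= G^dagger o G concludes. *)
Lemma transpose_monotone :
  monotone (ord \xb brel_id Y) le (ev \ob (G \xb brel_id Y)) -> monotone ord Q G.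
Proof.
case: homQ => _ _ maxQ monoF.
have GQ : G \ob ord \ob G^b <=b Q.
  apply: maxQ; rewrite !prod_comp_id !compA.
  apply: brel_le_trans (comp_le monoF (brel_le_refl _)) _.
  rewrite -!compA -prod_comp_id compA; apply: brel_le_trans.
    apply: comp_le (brel_le_refl _) _.
    apply: brel_le_trans (prod_le funG.2 (brel_le_refl _)) (@prod_id_le _ _ _).
  by rewrite comp_idr; apply: brel_le_refl.
rewrite /monotone -[G \ob ord]comp_idr.
apply: brel_le_trans (comp_le (brel_le_refl _) funG.1) _.
by rewrite compA; apply: comp_le GQ (brel_le_refl _).
Qed.

(** The order that [G] pulls back from [Q] is one along which the transposed
function increases: G o G^dagger <= I cancels the inner pair, and evaluation
increases along [Q]. *)
Lemma transpose_pullback :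
  monotone ((G^b \ob (Q \ob G)) \xb brel_id Y) le (ev \ob (G \xb brel_id Y)).
Proof.
case: homQ => _ evQ _; rewrite /monotone !prod_comp_id !compA.
apply: brel_le_trans (comp_le evQ (brel_le_refl _)).
apply: comp_le (brel_le_refl _).
apply: comp_le (brel_le_refl _).
rewrite -compA -prod_comp_id -{2}[ev]comp_idr.
apply: comp_le (brel_le_refl _) _.
exact: brel_le_trans (prod_le funG.2 (brel_le_refl _)) (@prod_id_le _ _ _).
Qed.

End InternalHom.

Theorem theorem9p5 (R : realType) (X : qset R[i]) (ord : brel X X)
    (P : brel (qprod X (qdual X)) (quote R[i] bool))
    (H : qset R[i]) (Q : brel H H) (ev : brel (qprod H (qdual X)) (quote R[i] bool)) :
  is_order ord ->
  is_function P ->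
  brel_comp (brel_adj (quote_true R[i])) P =
    brel_comp (dual_counit X) (brel_prod (brel_adj ord) (brel_id (qdual X))) ->
  is_internal_hom (quote_bool_le R[i]) Q ev ->
  monotone (brel_prod ord (brel_id (qdual X))) (quote_bool_le R[i]) P /\
  exists G : brel X H,
    unique (fun G' : brel X H =>
      [/\ is_function G', monotone ord Q G'
        & brel_comp ev (brel_prod G' (brel_id (qdual X))) = P]) G /\
    order_embedding ord Q G.
Proof.
move=> [refl trans _] funP trueP homQ.
have monoP : monotone (ord \xb brel_id (qdual X)) (quote_bool_le R[i]) P.
  exact/(monotone_lower_setP funP trueP).
split=> //; case: (homQ) => -[_ expo] _ _.
have [G [[funG evG] uniqG]] := expo X P funP; exists G.
have monoG : monotone ord Q G.
  by apply: (transpose_monotone funG homQ); rewrite evG.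
split; first by split=> // G' [funG' _ evG']; apply: uniqG.
apply: brel_le_anti.
  apply: brel_le_trans (comp_le (brel_le_refl _) monoG).
  rewrite compA -{1}[ord]comp_idl.
  exact: comp_le funG.1 (brel_le_refl _).
have /(monotone_lower_setP funP trueP) : monotone ((G^b \ob (Q \ob G)) \xb brel_id (qdual X))
    (quote_bool_le R[i]) P.
  by rewrite -evG; apply: transpose_pullback.
apply: brel_le_trans; rewrite -{1}[_ \ob (Q \ob G)]comp_idr.
exact: comp_le (brel_le_refl _) refl.
Qed.
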